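(* Let $\mathbb{K}$ be a field and suppose $\Delta$ is a PR complex (over $\mathbb{K}$) on vertex set $V$ with degree type $\mathbf{d}=(d_p,\dots,d_1)$, $p\ge1$. The complex $f^{\mathrm{free}}(\Delta)$ is PR (over $\mathbb{K}$) with degree type $(d_p,\dots,d_2,d_1+1)$.
   Context: The operation $f^{\mathrm{free}}$: let $\Delta$ be a simplicial complex on a finite vertex set $V$ with facets $F_1,\dots,F_m$. Let $\widetilde V=V\sqcup\{u_{F_1},\dots,u_{F_m}\}$ with $u_{F_1},\dots,u_{F_m}$ distinct new vertices. Then $f^{\mathrm{free}}(\Delta)$ is the simplicial complex on $\widetilde V$ with facets $F_1\cup\{u_{F_1}\},\dots,F_m\cup\{u_{F_m}\}$. PR complexes: $\widetilde{H}_i$ is reduced simplicial homology with coefficients in $\mathbb{K}$ (with $\widetilde H_{-1}(\{\emptyset\})=\mathbb{K}$), and $\mathrm{link}_\Delta\sigma=\{\tau\in\Delta:\sigma\cap\tau=\emptyset,\sigma\cup\tau\in\Delta\}$ for a face $\sigma$. A simplicial complex $\Delta$ is PR (over $\mathbb{K}$) if for every $i\ge-1$ and all faces $\sigma,\tau\in\Delta$ with $\widetilde H_i(\mathrm{link}_\Delta\sigma)\ne0\ne\widetilde H_i(\mathrm{link}_\Delta\tau)$ we have $|\sigma|=|\tau|$. For a PR complex $\Delta$, let $p$ be the maximum index for which some face $\sigma$ has $\widetilde H_{p-1}(\mathrm{link}_\Delta\sigma)\neq0$. For each $0\le i\le p$ faces $\sigma$ with $\widetilde H_{i-1}(\mathrm{link}_\Delta\sigma)\ne0$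 exist; let $s_i$ be their common size. The degree type of $\Delta$ is $(d_p,\dots,d_1)$ with $d_i=s_{i-1}-s_i$ (these are positive integers). *)

(* Defs.v *)
From HB Require Import structures.
From mathcomp Require Import all_boot all_order all_algebra.

Set Implicit Arguments.
Unset Strict Implicit.
Unset Printing Implicit Defensive.

Import GRing.Theory.
Local Open Scope ring_scope.

(* Not every element of V need be a vertex of the complex, and the void complex
   (no faces at all) is allowed; the complex whose only face is set0 is {∅}. *)
Record simplicial_complex (V : finType) := SimplicialComplex {
  faces :> {set {set V}};
  faces_down : forall s t : {set V}, t \subset s -> s \in faces -> t \in faces
}.

Definition facets (V : finType) (D : simplicial_complex V) : {set {set V}} :=
  [set F | maxset [in faces D] F].

Lemma link_subproof (V : finType) (D : simplicial_complex V) (s : {set V}) :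
  let L := [set t in faces D | [disjoint s & t] & s :|: t \in faces D] in
  forall t u : {set V}, u \subset t -> t \in L -> u \in L.
Proof.
move=> L t u ut; rewrite !inE => /and3P[tD st stD]; apply/and3P; split.
- exact: faces_down ut tD.
- exact: disjointWr ut st.
- exact: faces_down (setUS s ut) stD.
Qed.

Definition link (V : finType) (D : simplicial_complex V) (s : {set V}) :
  simplicial_complex V := SimplicialComplex (@link_subproof V D s).

Lemma generated_subproof (V : finType) (S : {set {set V}}) :
  let G := [set t : {set V} | [exists F in S, t \subset F]] in
  forall s t : {set V}, t \subset s -> s \in G -> t \in G.
Proof.
move=> G s t ts; rewrite !inE => /exists_inP[F FS sF].
by apply/exists_inP; exists F => //; apply: subset_trans ts sF.
Qed.

Definition generated (V : finType) (S : {set {set V}}) : simplicial_complex V :=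
  SimplicialComplex (@generated_subproof V S).

Section FFree.
Variables (V : finType) (D : simplicial_complex V).

Definition free_vertex : finType := (V + {F : {set V} | F \in facets D})%type.

Definition free_facet (F : {F : {set V} | F \in facets D}) : {set free_vertex} :=
  inr F |: [set inl v | v in val F].

Definition f_free : simplicial_complex free_vertex :=
  generated [set free_facet F | F : {F : {set V} | F \in facets D}].

Lemma facets_f_free :
  facets f_free = [set free_facet F | F : {F : {set V} | F \in facets D}].
Proof.
have inr_facet F G : (inr F \in free_facet G) = (F == G).
  rewrite !inE [X in _ || X](_ : _ = false) ?orbF //.
  by apply/imsetP=> -[].
apply/setP=> A; rewrite inE; apply/maxsetP/imsetP=> [[]|[F _ ->]].
  rewrite !inE => /exists_inP[B /imsetP[F _ ->] AF] maxA; exists F => //.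
  rewrite [RHS]maxA // !inE; apply/exists_inP.
  by exists (free_facet F); rewrite ?imset_f.
split=> [|B]; rewrite !inE.
  by apply/exists_inP; exists (free_facet F); rewrite ?imset_f.
case/exists_inP=> _ /imsetP[G _ ->] BG FB; apply/eqP; rewrite eqEsubset FB andbT.
suff -> : F = G by [].
by apply/eqP; rewrite -inr_facet (subsetP (subset_trans FB BG)) // inr_facet.
Qed.

End FFree.

(* Degrees are shifted by one so as to be natural numbers: index k always stands
   for homological degree k - 1, i.e. for faces with k vertices. All chains live
   in the functions on {set V}, a basis of which is given by the sets [s], each
   oriented by the order of V given by enum_rank. *)
Section Homology.
Variables (K : fieldType) (V : finType).

Definition chain_space : vectType K := {ffun {set V} -> K^o}.

Definition simplex (s : {set V}) : chain_space := [ffun t => (t == s)%:R].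

Definition position (s : {set V}) (v : V) : nat :=
  #|[set w in s | (enum_rank w < enum_rank v)%N]|.

Definition boundary_fun (c : chain_space) : chain_space :=
  \sum_(s : {set V}) \sum_(v in s)
     ((-1) ^+ position s v * (c : {ffun _ -> _}) s) *: simplex (s :\ v).

Lemma boundary_fun_is_linear : linear boundary_fun.
Proof.
move=> a c c'; rewrite /boundary_fun scaler_sumr -big_split /=.
apply: eq_bigr => s _; rewrite scaler_sumr -big_split /=.
apply: eq_bigr => v _; rewrite !ffunE scalerA -scalerDl mulrDr.
by rewrite [X in _ * X](_ : _ = a * (c : {ffun _ -> _}) s) // mulrCA.
Qed.

HB.instance Definition _ :=
  GRing.isLinear.Build K chain_space chain_space *:%R boundary_fun
    boundary_fun_is_linear.

Definition boundary : 'End(chain_space) := linfun boundary_fun.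

Lemma boundary_simplex (s : {set V}) :
  boundary (simplex s) =
  \sum_(v in s) (-1) ^+ position s v *: simplex (s :\ v).
Proof.
rewrite lfunE /= /boundary_fun (bigD1 s) //= [X in _ + X]big1 ?addr0 => [|t ts].
  by apply: eq_bigr => v _; rewrite ffunE eqxx mulr1.
by rewrite big1 // => v _; rewrite ffunE (negPf ts) mulr0 scale0r.
Qed.

Lemma positionD1 (s : {set V}) (v w : V) : v \in s ->
  position s w = ((enum_rank v < enum_rank w)%N + position (s :\ v) w)%N.
Proof.
move=> vs; rewrite /position (cardsD1 v) inE vs /=; congr (_ + _)%N.
by apply: eq_card => u; rewrite !inE andbA.
Qed.

Lemma boundary_boundary_simplex (s : {set V}) :
  boundary (boundary (simplex s)) = 0.
Proof.
rewrite boundary_simplex linear_sum /=.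
under eq_bigr => v _ do rewrite linearZ /= boundary_simplex scaler_sumr.
rewrite pair_big_dep /= (bigID (fun x => (enum_rank x.1 < enum_rank x.2)%N)) /=.
have swapK : cancel (fun x : V * V => (x.2, x.1)) (fun x => (x.2, x.1)).
  by case.
rewrite [X in _ + X](reindex_inj (can_inj swapK)) /=.
rewrite [X in _ + X](eq_bigl
  (fun x => [&& x.1 \in s, x.2 \in s :\ x.1 & (enum_rank x.1 < enum_rank x.2)%N]));
  last first.
  case=> v w /=; rewrite !inE -leqNgt leq_eqVlt.
  rewrite (inj_eq val_inj) (inj_eq enum_rank_inj) (eq_sym v w).
  by case: (w == v); case: (v \in s); case: (w \in s).
under eq_bigl => x do rewrite -andbA.
rewrite -big_split /=; apply: big1 => -[v w] /= /and3P[vs].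
rewrite !inE => /andP[wv ws] lt_vw; rewrite !scalerA.
have -> : s :\ w :\ v = s :\ v :\ w by rewrite !setDDl setUC.
rewrite -scalerDl (positionD1 w vs) lt_vw (positionD1 v ws) ltnNge ltnW //=.
by rewrite add0n exprS mulN1r mulNr [X in _ - X]mulrC subrr scale0r.
Qed.

Variable D : simplicial_complex V.

Definition chains (k : nat) : {vspace chain_space} :=
  <<[seq simplex s | s : {set V} <- enum (faces D) & #|s| == k]>>%VS.

Definition cycles (k : nat) : {vspace chain_space} :=
  (chains k :&: lker boundary)%VS.

Definition boundaries (k : nat) : {vspace chain_space} :=
  (boundary @: chains k.+1)%VS.

Lemma boundary_boundary k : (boundaries k <= lker boundary)%VS.
Proof.
apply/subvP=> _ /memv_imgP[c cC ->]; rewrite memv_ker; apply/eqP.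
have /subvP/(_ _ cC) : (chains k.+1 <= lker (boundary \o boundary)%VF)%VS.
  apply/span_subvP=> _ /mapP[s _ ->].
  by rewrite memv_ker comp_lfunE boundary_boundary_simplex.
by rewrite memv_ker comp_lfunE => /eqP.
Qed.

Definition is_boundary (k : nat) (z : subvs_of (cycles k)) : bool :=
  vsval z \in boundaries k.

Lemma is_boundary_zmod_closed k : zmod_closed (@is_boundary k).
Proof.
split=> [|x y]; rewrite !unfold_in /is_boundary; first exact: mem0v.
exact: memvB.
Qed.

HB.instance Definition _ k :=
  GRing.isZmodClosed.Build (subvs_of (cycles k)) (@is_boundary k)
    (is_boundary_zmod_closed k).

Definition boundary_closed k : zmodClosed (subvs_of (cycles k)) :=
  GRing.ZmodClosed.clone _ (@is_boundary k) _.

(* The reduced homology group of degree k - 1. *)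
Definition reduced_homology (k : nat) : zmodType :=
  {ideal_quot (boundary_closed k)}.

Definition nonzero_homology (k : nat) : Prop :=
  exists h : reduced_homology k, h != 0.

Lemma nonzero_homologyP k :
  nonzero_homology k <-> ~~ (cycles k <= boundaries k)%VS.
Proof.
have piE0 (z : subvs_of (cycles k)) :
    (\pi_{ideal_quot boundary_closed k}%qT z == 0) = (vsval z \in boundaries k).
  have <- : \pi_{ideal_quot boundary_closed k}%qT 0 = 0 by exact: pi_zeror.
  by rewrite -Quotient.idealrBE subr0.
split=> [[h]|/subvPn[z zZ zB]].
  rewrite -[h]reprK piE0; apply: contra => /subvP; apply; exact: subvsP.
by exists (\pi_{ideal_quot boundary_closed k}%qT (Subvs zZ)); rewrite piE0.
Qed.

End Homology.

Definition PR (K : fieldType) (V : finType) (D : simplicial_complex V) : Prop :=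
  forall (k : nat) (s t : {set V}), s \in faces D -> t \in faces D ->
    nonzero_homology K (link D s) k -> nonzero_homology K (link D t) k ->
    #|s| = #|t|.

(* The sequence d lists d_p, ..., d_1 in this order, so that p = size d and
   d_i is its entry of index p - i. The sizes s_i are unique when D is PR. *)
Definition degree_type (K : fieldType) (V : finType)
    (D : simplicial_complex V) (d : seq int) : Prop :=
  let p := size d in
  exists sz : nat -> nat,
  [/\ forall (k : nat) (s : {set V}),
        s \in faces D -> nonzero_homology K (link D s) k -> (k <= p)%N,
      forall i : nat, (i <= p)%N ->
        exists s : {set V},
          [/\ s \in faces D, nonzero_homology K (link D s) i & #|s| = sz i]
    & forall i : nat, (1 <= i <= p)%N ->
        nth 0 d (p - i)%N = (sz i.-1)%:Z - (sz i)%:Z].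

(* Main.v *)
(* The vertex u_F lies in no facet but F + u_F. So if A is a face of D that is
   not a facet, every facet F containing A contributes to the link of A in
   f_free D a cone over the nonempty simplex F \ A of link D A, which does not
   change the homology. If A is a facet, its link in f_free D is a point, hence
   acyclic; the link of A + u_F is the simplex on F \ A, which is acyclic unless
   A = F. Hence homology in nonnegative degrees sits at the same faces as in D, and
   the faces carrying homology in degree -1 change from F to F + u_F: s_0 grows
   by one and the other s_i stay the same. *)
From HB Require Import structures.
Require Import Defs.
From mathcomp Require Import all_boot all_order all_algebra.

Set Implicit Arguments.
Unset Strict Implicit.
Unset Printing Implicit Defensive.

Import GRing.Theory.
Local Open Scope ring_scope.

Section Homology.
Variable K : fieldType.
Implicit Types V W : finType.

(** * Linear maps on chains and comparison of homology *)

Section LinearExtension.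
Variables (V W : finType) (phi : {set V} -> chain_space K W).

Definition extension_fun (c : chain_space K V) : chain_space K W :=
  \sum_(s : {set V}) (c : {ffun _ -> _}) s *: phi s.

Lemma extension_fun_is_linear : linear extension_fun.
Proof.
move=> a c c'; rewrite /extension_fun scaler_sumr -big_split /=.
by apply: eq_bigr => s _; rewrite !ffunE scalerA -scalerDl.
Qed.

HB.instance Definition _ :=
  GRing.isLinear.Build K (chain_space K V) (chain_space K W) *:%R extension_fun
    extension_fun_is_linear.

Definition extension : 'Hom(chain_space K V, chain_space K W) :=
  linfun extension_fun.

Lemma extension_simplex (s : {set V}) : extension (simplex K s) = phi s.
Proof.
rewrite lfunE /= /extension_fun (bigD1 s) //= big1 ?addr0 => [|t ts].
  by rewrite ffunE eqxx scale1r.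
by rewrite ffunE (negPf ts) scale0r.
Qed.

End LinearExtension.

Lemma chain_sum V (c : chain_space K V) :
  c = \sum_(s : {set V}) (c : {ffun _ -> _}) s *: simplex K s.
Proof.
apply/ffunP => t; rewrite sum_ffunE (bigD1 t) //= big1 => [|s st].
  by rewrite !ffunE eqxx addr0 [RHS]mulr1.
by rewrite !ffunE eq_sym (negPf st) scaler0.
Qed.

Lemma eq_on_simplices V (vT : vectType K) (f g : 'Hom(chain_space K V, vT)) :
  (forall s, f (simplex K s) = g (simplex K s)) -> f = g.
Proof.
move=> fg; apply/lfunP => c; rewrite (chain_sum c) !linear_sum /=.
by apply: eq_bigr => s _; rewrite !linearZ /= fg.
Qed.

Lemma boundary2 V (c : chain_space K V) : boundary K V (boundary K V c) = 0.
Proof.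
have /lfunP/(_ c) : (boundary K V \o boundary K V)%VF = 0.
  apply: eq_on_simplices => s.
  by rewrite comp_lfunE boundary_boundary_simplex zero_lfunE.
by rewrite comp_lfunE zero_lfunE.
Qed.

(** Chains are a span, so membership is tested on simplices. Taking [f] to be the identity gives
    inclusions between chain spaces. *)
Lemma chains_subP V (D : simplicial_complex V) k (vT : vectType K)
    (f : 'Hom(chain_space K V, vT)) (U : {vspace vT}) :
  (forall s, s \in faces D -> #|s| = k -> f (simplex K s) \in U) ->
  forall c, c \in chains K D k -> f c \in U.
Proof.
move=> fU c cC; suff : (chains K D k <= f @^-1: U)%VS.
  by move/subvP/(_ _ cC); rewrite -memv_preim.
apply/span_subvP=> _ /mapP[s + ->]; rewrite mem_filter mem_enum -memv_preim.
by case/andP=> /eqP sk sD; apply: fU.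
Qed.

Lemma eq_on_chains V (D : simplicial_complex V) k (vT : vectType K)
    (f g : 'Hom(chain_space K V, vT)) :
  (forall s, s \in faces D -> #|s| = k -> f (simplex K s) = g (simplex K s)) ->
  forall c, c \in chains K D k -> f c = g c.
Proof.
move=> fg c cC; apply/eqP; rewrite -subr_eq0 -memv0.
have := @chains_subP V D k vT (f - g) 0%VS _ c cC.
rewrite add_lfunE opp_lfunE; apply=> s sD sk.
by rewrite add_lfunE opp_lfunE fg // subrr mem0v.
Qed.

Lemma simplex_chain V (D : simplicial_complex V) k (s : {set V}) :
  s \in faces D -> #|s| = k -> simplex K s \in chains K D k.
Proof.
move=> sD sk; apply: memv_span; apply/mapP; exists s => //.
by rewrite mem_filter sk eqxx mem_enum.
Qed.

Lemma mem_cycles V (D : simplicial_complex V) k (z : chain_space K V) :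
  (z \in cycles K D k) = (z \in chains K D k) && (boundary K V z == 0).
Proof. by rewrite memv_cap memv_ker. Qed.

(** Up to boundaries [g] undoes [f]: if [f z] bounds, then so do [g (f z)] and [z]. Plain functions
    are allowed so that [id] can serve as an inclusion. *)
Lemma nonzero_homology_transfer V W (D : simplicial_complex V)
    (E : simplicial_complex W) k
    (f : chain_space K V -> chain_space K W)
    (g : chain_space K W -> chain_space K V) :
    (forall z, z \in cycles K D k -> f z \in cycles K E k) ->
    (forall b, b \in boundaries K E k -> g b \in boundaries K D k) ->
    (forall z, z \in cycles K D k -> z - g (f z) \in boundaries K D k) ->
  nonzero_homology K D k -> nonzero_homology K E k.
Proof.
move=> fZ gB fg /nonzero_homologyP/subvPn[z zZ zB]; apply/nonzero_homologyP.
apply: contra zB => /subvP EB; rewrite -(subrK (g (f z)) z).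
by apply: memvD; [apply: fg | apply/gB/EB/fZ].
Qed.

(** * The cone operator and acyclicity of cones *)

Section Cone.
Variables (V : finType) (v : V).

(** The sign is the one with which [s] occurs in the boundary of [v |: s], because [v] does not
    count itself in [position]. *)
Definition cone : 'End(chain_space K V) := extension (fun s =>
  if v \in s then 0 else (-1) ^+ position s v *: simplex K (v |: s)).

Lemma cone_simplex (s : {set V}) : cone (simplex K s) =
  if v \in s then 0 else (-1) ^+ position s v *: simplex K (v |: s).
Proof. exact: extension_simplex. Qed.

(** If [v] is in [s], only the boundary term omitting [v] survives the cone and gives [s] back.
    Otherwise the boundary of [v |: s] yields [s] and terms omitting some [w] in [s], which cancel
    against the cone of the boundary. *)
Lemma cone_homotopy (c : chain_space K V) :
  boundary K V (cone c) + cone (boundary K V c) = c.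
Proof.
have /lfunP/(_ c) : ((boundary K V \o cone) + (cone \o boundary K V) = \1)%VF.
  apply: eq_on_simplices => s.
  rewrite add_lfunE id_lfunE !comp_lfunE cone_simplex.
  rewrite boundary_simplex linear_sum /=.
  under eq_bigr => w _ do rewrite linearZ /= cone_simplex.
  case: ifPn => vs.
    rewrite linear0 add0r (bigD1 v) //= big1 ?addr0 => [|w /andP[ws wv]].
      rewrite setD11 setD1K // (positionD1 v vs) ltnn add0n scalerA.
      by rewrite -expr2 sqrr_sign scale1r.
    by rewrite !inE eq_sym wv vs scaler0.
  rewrite linearZ /= boundary_simplex big_setU1 //= setU1K // scalerDr.
  rewrite (positionD1 v (setU11 v s)) setU1K // ltnn add0n scalerA -expr2.
  rewrite sqrr_sign scale1r -addrA scaler_sumr -big_split /=.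
  rewrite big1 ?addr0 // => w ws.
  have wv : w != v by apply: contraNneq vs => <-.
  rewrite !inE (negPf vs) andbF !scalerA.
  have -> : (v |: s) :\ w = v |: s :\ w.
    by apply/setP => x; rewrite !inE; case: eqVneq => // ->; rewrite (negPf wv).
  rewrite -scalerDl (positionD1 w (setU11 v s)) setU1K // (positionD1 v ws).
  (* Whichever of [v] and [w] comes first shifts the position of the other by one, so the two signs
     are opposite. *)
  rewrite -!exprD; case: ltngtP => [lt|lt|/val_inj/enum_rank_inj e].
  - by rewrite add0n addSn exprS mulN1r addnC addNr scale0r.
  - by rewrite add0n addnS exprS mulN1r addnC addNr scale0r.
  - by rewrite e eqxx in wv.
by rewrite add_lfunE id_lfunE !comp_lfunE.
Qed.

Lemma cone_simplex_chain (D : simplicial_complex V) k (s : {set V}) :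
  v |: s \in faces D -> #|s| = k -> cone (simplex K s) \in chains K D k.+1.
Proof.
move=> vsD sk; rewrite cone_simplex.
case: ifPn => vs; first exact: mem0v.
by apply/memvZ/simplex_chain => //; rewrite cardsU1 vs sk.
Qed.

(** By [cone_homotopy] a cycle is the boundary of its own cone. *)
Lemma cone_acyclic (D : simplicial_complex V) k :
  (forall s, s \in faces D -> v |: s \in faces D) -> ~ nonzero_homology K D k.
Proof.
move=> Dv /nonzero_homologyP/subvPn[z]; rewrite mem_cycles => /andP[zC /eqP dz].
apply/negP; rewrite negbK -(cone_homotopy z) dz linear0 addr0.
apply/memv_img; move: zC; apply: chains_subP => s sD.
exact/cone_simplex_chain/Dv.
Qed.

End Cone.

(** * Deleting dominated vertices *)

Lemma deletion_subproof V (D : simplicial_complex V) (U : {set V}) :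
  let L := [set s in faces D | [disjoint U & s]] in
  forall s t : {set V}, t \subset s -> s \in L -> t \in L.
Proof.
move=> L s t ts; rewrite !inE => /andP[sD Us].
by rewrite (faces_down ts sD) (disjointWr ts Us).
Qed.

Definition deletion V (D : simplicial_complex V) (U : {set V}) :=
  SimplicialComplex (@deletion_subproof V D U).

Section Deletion.
Variables (V : finType) (D : simplicial_complex V) (U : {set V}) (v : V -> V).
(** Together the hypotheses say that the link of each [u] in [U] is a cone with apex [v u] outside
    [U], and that no face meets [U] twice, so that all of [U] can be removed in one go. *)
Hypothesis U_indep : forall s u w,
  s \in faces D -> u \in U -> w \in U -> u \in s -> w \in s -> u = w.
Hypothesis vU : forall u, u \in U -> v u \notin U.
Hypothesis Dv : forall s u,
  s \in faces D -> u \in U -> u \in s -> v u |: s \in faces D.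

(* The homotopy that slides [u] to [v u]; [retract], which it joins to the
   identity, is thus a chain map, and it lands in the deletion of [U]. *)
Definition pull : 'End(chain_space K V) :=
  extension (fun s => \sum_(u in U :&: s) cone (v u) (simplex K s)).

Definition retract : 'End(chain_space K V) :=
  (\1 - (boundary K V \o pull) - (pull \o boundary K V))%VF.

Lemma pull_simplex (s : {set V}) :
  pull (simplex K s) = \sum_(u in U :&: s) cone (v u) (simplex K s).
Proof. exact: extension_simplex. Qed.

Lemma retractE c :
  retract c = c - boundary K V (pull c) - pull (boundary K V c).
Proof. by rewrite !(comp_lfunE, add_lfunE, opp_lfunE, id_lfunE). Qed.

Lemma boundary_retract c :
  boundary K V (retract c) = retract (boundary K V c).
Proof. by rewrite !retractE !linearB /= !boundary2 [pull 0]linear0 !subr0. Qed.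

Lemma pull_simplex0 (s : {set V}) : [disjoint U & s] -> pull (simplex K s) = 0.
Proof.
by rewrite -setI_eq0 => /eqP Us; rewrite pull_simplex Us big_set0.
Qed.

Lemma pull_simplex1 (s : {set V}) (u : V) :
  s \in faces D -> u \in U -> u \in s ->
  pull (simplex K s) = cone (v u) (simplex K s).
Proof.
move=> sD uU us; rewrite pull_simplex (_ : U :&: s = [set u]) ?big_set1 //.
apply/setP => w; rewrite !inE; apply/andP/eqP => [[wU ws]|-> //].
exact: U_indep sD wU uU ws us.
Qed.

Lemma retract_simplex0 (s : {set V}) : [disjoint U & s] ->
  retract (simplex K s) = simplex K s.
Proof.
move=> Us; rewrite retractE pull_simplex0 // linear0 subr0 boundary_simplex.
rewrite linear_sum big1 ?subr0 // => w _; rewrite linearZ /=.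
by rewrite pull_simplex0 ?scaler0 //; apply: disjointWr Us; apply: subD1set.
Qed.

(** By [cone_homotopy], the simplex minus the boundary of its pull is the cone of its boundary.
    Subtracting the pull of the boundary removes every term still containing [u]; what is left has
    [u] replaced by [v u]. *)
Lemma retract_simplex1 (s : {set V}) (u : V) :
  s \in faces D -> u \in U -> u \in s ->
  retract (simplex K s) =
  (-1) ^+ position s u *: cone (v u) (simplex K (s :\ u)).
Proof.
move=> sD uU us; rewrite retractE (pull_simplex1 sD uU us).
have /esym/eqP := cone_homotopy (v u) (simplex K s).
rewrite addrC -subr_eq => /eqP->.
rewrite boundary_simplex [cone _ _]linear_sum [pull _]linear_sum /= (bigD1 u) //=.
rewrite [X in _ - X](bigD1 u) //=.
(* As [u] is the only vertex of [s] in [U], the face [s :\ u] avoids [U] and is killed by [pull]. *)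
rewrite !linearZ /= [X in _ - (_ *: X + _)]pull_simplex0; last first.
  rewrite -setI_eq0; apply/eqP/setP => w; rewrite !inE; apply/and3P => -[wU wu ws].
  by rewrite (U_indep sD wU uU ws us) eqxx in wu.
rewrite scaler0 add0r -addrA -sumrB big1 ?addr0 // => w /andP[ws wu].
rewrite !linearZ /= (@pull_simplex1 _ u) ?scalerN ?subrr //.
- exact: faces_down (subD1set s w) sD.
- by rewrite !inE eq_sym wu.
Qed.

Lemma retract_chain k c :
  c \in chains K D k -> retract c \in chains K (deletion D U) k.
Proof.
apply: chains_subP => s sD sk; have [Us|] := boolP [disjoint U & s].
  by rewrite retract_simplex0 //; apply: simplex_chain; rewrite // inE sD.
rewrite -setI_eq0 => /set0Pn[u]; rewrite inE => /andP[uU us].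
rewrite (retract_simplex1 sD uU us); apply: memvZ.
rewrite -sk (cardsD1 u) us; apply: cone_simplex_chain => //; rewrite inE.
rewrite (faces_down _ (Dv sD uU us)) ?setUS ?subD1set //=.
rewrite -setI_eq0; apply/eqP/setP => w; rewrite !inE.
apply/andP => -[wU /orP[/eqP wv|/andP[wu ws]]].
  by rewrite wv (negPf (vU uU)) in wU.
by rewrite (U_indep sD wU uU ws us) eqxx in wu.
Qed.

Lemma retract_id k c : c \in chains K (deletion D U) k -> retract c = c.
Proof.
move=> cC; rewrite -[RHS]id_lfunE; apply: eq_on_chains cC => s.
by rewrite inE id_lfunE => /andP[_ Us] _; apply: retract_simplex0.
Qed.

Lemma pull_chain k c : c \in chains K D k -> pull c \in chains K D k.+1.
Proof.
apply: chains_subP => s sD sk; rewrite pull_simplex; apply: memv_suml => u.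
rewrite inE => /andP[uU us]; apply: cone_simplex_chain => //; exact: Dv.
Qed.

Lemma deletion_chain k c : c \in chains K (deletion D U) k -> c \in chains K D k.
Proof.
rewrite -{2}[c]id_lfunE; apply: chains_subP => s; rewrite inE => /andP[sD _] sk.
by rewrite id_lfunE; apply: simplex_chain.
Qed.

(** Inclusion and [retract] are inverse on homology: [retract] fixes chains of the deletion, and a
    cycle differs from its retract by the boundary of its pull. *)
Lemma nonzero_homology_deletion k :
  nonzero_homology K (deletion D U) k <-> nonzero_homology K D k.
Proof.
split; [apply: (@nonzero_homology_transfer _ _ _ _ _ id retract)
       |apply: (@nonzero_homology_transfer _ _ _ _ _ retract id)].
- by move=> z; rewrite !mem_cycles => /andP[/deletion_chain-> ->].
- move=> _ /memv_imgP[c cC ->]; rewrite -boundary_retract.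
  exact/memv_img/retract_chain.
- move=> z; rewrite mem_cycles => /andP[zC _].
  by rewrite (retract_id zC) subrr mem0v.
- move=> z; rewrite !mem_cycles => /andP[zC /eqP dz].
  by rewrite retract_chain // boundary_retract dz linear0 eqxx.
- by move=> _ /memv_imgP[c cC ->]; apply/memv_img/deletion_chain.
- move=> z; rewrite !mem_cycles => /andP[zC /eqP dz].
  rewrite retractE dz linear0 subr0 opprB addrC subrK.
  exact/memv_img/pull_chain.
Qed.

End Deletion.

(** * Order-preserving relabelling of vertices *)

Section Relabel.
Variables (V W : finType) (f : V -> W).
(** Preserving the order, and not merely being injective, keeps all positions, so [push] is a chain
    map without sign corrections. *)
Hypothesis f_mono : forall v w,
  (enum_rank (f v) < enum_rank (f w))%N = (enum_rank v < enum_rank w)%N.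
Variables (D : simplicial_complex V) (E : simplicial_complex W).
Hypothesis DE : faces E = [set f @: s | s : {set V} in faces D].

Lemma f_inj : injective f.
Proof.
move=> v w fvw; case: (ltngtP (enum_rank v) (enum_rank w)).
- by rewrite -f_mono fvw ltnn.
- by rewrite -f_mono fvw ltnn.
- by move/val_inj/enum_rank_inj.
Qed.

Definition push : 'Hom(chain_space K V, chain_space K W) :=
  extension (fun s => simplex K (f @: s)).

Definition pop : 'Hom(chain_space K W, chain_space K V) :=
  extension (fun t => simplex K (f @^-1: t)).

Lemma push_simplex (s : {set V}) : push (simplex K s) = simplex K (f @: s).
Proof. exact: extension_simplex. Qed.

Lemma pop_simplex (t : {set W}) : pop (simplex K t) = simplex K (f @^-1: t).
Proof. exact: extension_simplex. Qed.

Lemma position_imset (s : {set V}) v : position (f @: s) (f v) = position s v.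
Proof.
rewrite /position -[RHS](card_imset _ f_inj); apply: eq_card => w.
rewrite inE; apply/andP/imsetP => [[/imsetP[x xs ->] xv]|[x + ->]].
  by exists x; rewrite // inE xs -f_mono.
by rewrite inE => /andP[xs xv]; rewrite imset_f // f_mono.
Qed.

Lemma boundary_push c : boundary K W (push c) = push (boundary K V c).
Proof.
have /lfunP/(_ c) : (boundary K W \o push = push \o boundary K V)%VF.
  apply: eq_on_simplices => s; rewrite !comp_lfunE push_simplex.
  rewrite !boundary_simplex linear_sum /= big_imset /=; last exact: in2W f_inj.
  apply: eq_bigr => v vs; rewrite linearZ /= push_simplex position_imset.
  have -> // : f @: s :\ f v = f @: (s :\ v).
  rewrite -{1}(setD1K vs) imsetU1 setU1K //.
  by rewrite mem_imset ?setD11 //; exact: f_inj.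
by rewrite !comp_lfunE.
Qed.

Lemma preim_imset (s : {set V}) : f @^-1: (f @: s) = s.
Proof. by apply/setP => v; rewrite inE mem_imset //; exact: f_inj. Qed.

Lemma push_chain k c : c \in chains K D k -> push c \in chains K E k.
Proof.
apply: chains_subP => s sD sk; rewrite (push_simplex, pop_simplex).
by apply: simplex_chain; rewrite ?DE ?imset_f // card_imset //; exact: f_inj.
Qed.

Lemma pop_chain k c : c \in chains K E k -> pop c \in chains K D k.
Proof.
apply: chains_subP => s; rewrite DE => /imsetP[t tD ->] tk.
rewrite (push_simplex, pop_simplex) preim_imset; apply: simplex_chain => //.
by rewrite -tk card_imset //; exact: f_inj.
Qed.

Lemma pushK c : pop (push c) = c.
Proof.
have /lfunP/(_ c) : (pop \o push = \1)%VF.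
  apply: eq_on_simplices => s.
  by rewrite comp_lfunE id_lfunE push_simplex pop_simplex preim_imset.
by rewrite comp_lfunE id_lfunE.
Qed.

Lemma popK k c : c \in chains K E k -> push (pop c) = c.
Proof.
move=> cC; rewrite -comp_lfunE -[RHS]id_lfunE; apply: eq_on_chains cC => s.
rewrite DE => /imsetP[t tD ->] _.
by rewrite comp_lfunE id_lfunE pop_simplex preim_imset push_simplex.
Qed.

(** [pop] forgets vertices outside the image of [f], so it is not a chain map everywhere; a chain of
    [E] is the push of its pop, and [push] is a chain map. *)
Lemma boundary_pop k c : c \in chains K E k ->
  boundary K V (pop c) = pop (boundary K W c).
Proof. by move=> /popK {2}<-; rewrite boundary_push pushK. Qed.

Lemma nonzero_homology_relabel k :
  nonzero_homology K E k <-> nonzero_homology K D k.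
Proof.
split; [apply: (@nonzero_homology_transfer _ _ _ _ _ pop push)
       |apply: (@nonzero_homology_transfer _ _ _ _ _ push pop)].
- move=> z; rewrite !mem_cycles => /andP[zC /eqP dz].
  by rewrite pop_chain // (boundary_pop zC) dz linear0 eqxx.
- by move=> _ /memv_imgP[c cC ->]; rewrite -boundary_push; apply/memv_img/push_chain.
- by move=> z; rewrite mem_cycles => /andP[/popK-> _]; rewrite subrr mem0v.
- move=> z; rewrite !mem_cycles => /andP[zC /eqP dz].
  by rewrite push_chain // boundary_push dz linear0 eqxx.
- move=> _ /memv_imgP[c cC ->]; rewrite -(boundary_pop cC).
  exact/memv_img/pop_chain.
- by move=> z _; rewrite pushK subrr mem0v.
Qed.

End Relabel.

(** * Facets and the homology of their links *)

Section Facets.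
Variables (V : finType) (D : simplicial_complex V).

Lemma mem_linkP (s t : {set V}) :
  reflect ([disjoint s & t] /\ s :|: t \in faces D) (t \in faces (link D s)).
Proof.
rewrite inE; apply: (iffP and3P) => [[]//|[st stD]].
by split; rewrite // (faces_down _ stD) // subsetUr.
Qed.

Lemma link_facet (F t : {set V}) :
  F \in facets D -> t \in faces (link D F) -> t = set0.
Proof.
rewrite inE => /maxsetP[_ maxF] /mem_linkP[Ft FtD].
have tF : t \subset F by apply/setUidPl/maxF => //; apply: subsetUl.
by move: Ft; rewrite -setI_eq0 setIC (setIidPl tF) => /eqP.
Qed.

Lemma facet_cover (s : {set V}) : s \in faces D ->
  exists2 F, F \in facets D & s \subset F.
Proof.
by move=> /(@maxset_exists _ (mem (faces D)))[F maxF sF]; exists F; rewrite ?inE.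
Qed.

Lemma facet_extend (s : {set V}) : s \in faces D -> s \notin facets D ->
  exists v, [/\ v \notin s & v |: s \in faces D].
Proof.
move=> sD sN; have [F FD sF] := facet_cover sD.
have /subsetPn[v vF vs] : ~~ (F \subset s).
  by apply: contra sN => Fs; rewrite (_ : s = F) //; apply/eqP; rewrite eqEsubset sF.
exists v; split=> //; move: FD; rewrite inE => /maxsetp/faces_down; apply.
by rewrite subUset sub1set vF.
Qed.

Lemma boundary_simplex0 : boundary K V (simplex K set0) = 0.
Proof. by rewrite boundary_simplex big_set0. Qed.

(** Index 0 is degree -1, where the only simplex is the empty one. It bounds exactly when the link
    has a vertex, that is, when [s] can be enlarged. *)
Lemma facet_homology (s : {set V}) : s \in faces D ->
  nonzero_homology K (link D s) 0 <-> s \in facets D.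
Proof.
move=> sD; split=> [/nonzero_homologyP|sF].
  apply: contraR => /(facet_extend sD)[v [vs vsD]]; apply/subvP => z.
  rewrite mem_cycles => /andP[+ _]; rewrite -{2}[z]id_lfunE; apply: chains_subP => t.
  move=> _ /cards0_eq->; rewrite id_lfunE -(cone_homotopy v (simplex K set0)).
  rewrite boundary_simplex0 linear0 addr0; apply/memv_img/cone_simplex_chain.
    by apply/mem_linkP; split; rewrite // setU0 1?disjoint_sym ?disjoints1 // setUC.
  exact: cards0.
apply/nonzero_homologyP/subvPn; exists (simplex K set0).
  rewrite mem_cycles boundary_simplex0 eqxx andbT; apply: simplex_chain.
    by apply/mem_linkP; split; rewrite // ?setU0 // -setI_eq0 setI0.
  exact: cards0.
apply/negP => /memv_imgP[c cC].
(* The link of a facet has only the empty face, hence no simplices with one vertex. *)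
have -> : c = 0.
  apply/eqP; rewrite -memv0 -[c]id_lfunE; apply: chains_subP cC => t.
  by move=> /(link_facet sF)-> /eqP; rewrite cards0.
rewrite linear0 => /ffunP/(_ set0); rewrite !ffunE eqxx => /eqP.
by rewrite oner_eq0.
Qed.

Lemma facet_homologyS (F : {set V}) k : F \in facets D ->
  ~ nonzero_homology K (link D F) k.+1.
Proof.
move=> FD /nonzero_homologyP/subvPn[z]; rewrite mem_cycles => /andP[zC _].
apply/negP; rewrite negbK; apply: subvP (sub0v _) _ _.
rewrite -[z]id_lfunE; apply: chains_subP zC => t.
by move=> /(link_facet FD)-> /eqP; rewrite cards0.
Qed.

End Facets.

End Homology.

(** * Vertex order in a disjoint sum *)

Lemma enum_rank_index (T : finType) (x : T) :
  enum_rank x = index x (enum T) :> nat.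
Proof. by rewrite -{2}(nth_enum_rank x x) index_uniq ?enum_uniq -?cardE. Qed.

(** The enumeration of a sum lists the left summand first. This is what makes [inl] a relabelling
    that respects orientations. *)
Lemma enum_rank_inl (V W : finType) (v : V) :
  enum_rank (inl v : V + W) = enum_rank v :> nat.
Proof.
rewrite !enum_rank_index !enumT [in LHS]unlock.
rewrite index_cat ifT ?index_map //; first exact: inl_inj.
by apply: map_f; rewrite -enumT mem_enum.
Qed.

(** * Links in the free complex *)

Section FreeComplex.
Variables (K : fieldType) (V : finType) (D : simplicial_complex V).
Implicit Types (F G : {F : {set V} | F \in facets D}) (s : {set V}).

Let inl_set (s : {set V}) : {set free_vertex D} := [set inl v | v in s].

Lemma mem_f_free (t : {set free_vertex D}) :
  reflect (exists F, t \subset free_facet F) (t \in faces (f_free D)).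
Proof.
rewrite inE; apply: (iffP exists_inP) => [[_ /imsetP[F _ ->] tF]|[F tF]].
  by exists F.
by exists (free_facet F); rewrite ?imset_f.
Qed.

Lemma inl_free_facet F v : (inl v \in free_facet F) = (v \in val F).
Proof. by rewrite !inE mem_imset //; exact: inl_inj. Qed.

Lemma inr_free_facet F G : (inr G \in free_facet F) = (G == F).
Proof.
rewrite !inE; case: imsetP => [[]//|_]; rewrite orbF.
by apply/eqP/eqP => [[->]|->].
Qed.

Lemma inl_set_subset s F : (inl_set s \subset free_facet F) = (s \subset val F).
Proof.
apply/subsetP/subsetP => sF v; last first.
  by case/imsetP => w /sF wF ->; rewrite inl_free_facet.
by move=> vs; rewrite -inl_free_facet sF ?imset_f.
Qed.

Lemma facet_face F : val F \in faces D.
Proof. by have := valP F; rewrite inE => /maxsetp. Qed.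

Lemma inl_setU s t : inl_set (s :|: t) = inl_set s :|: inl_set t.
Proof. exact: imsetU. Qed.

Lemma inl_set_f_free s : (inl_set s \in faces (f_free D)) = (s \in faces D).
Proof.
apply/mem_f_free/idP => [[F]|/facet_cover[F FD sF]].
  by rewrite inl_set_subset => sF; apply: faces_down sF (facet_face F).
by exists (Sub F FD); rewrite inl_set_subset.
Qed.

Lemma f_free_inr (t : {set free_vertex D}) F :
  t \in faces (f_free D) -> inr F \in t -> t \subset free_facet F.
Proof.
by case/mem_f_free => G tG /(subsetP tG); rewrite inr_free_facet => /eqP->.
Qed.

Lemma inl_set_preim (t : {set free_vertex D}) :
  (forall F, inr F \notin t) -> t = inl_set [set v | inl v \in t].
Proof.
move=> tN; apply/setP => -[v|F].
  by rewrite mem_imset ?inE //; exact: inl_inj.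
by rewrite (negPf (tN F)); apply/esym/imsetP => -[].
Qed.

Lemma card_free_facet F : #|free_facet F| = #|val F|.+1.
Proof.
rewrite cardsU1 card_imset; last exact: inl_inj.
by case: imsetP => // -[].
Qed.

(** All faces containing [inr F] lie in the one facet [free_facet F], so the link of [t] is a full
    simplex: only the empty face if [t] is that facet, and otherwise a cone over any further
    vertex. *)
Lemma link_f_free_inr (t : {set free_vertex D}) F k :
  t \in faces (f_free D) -> inr F \in t ->
  ~ nonzero_homology K (link (f_free D) t) k.+1.
Proof.
move=> tD Ft; have [/facet_homologyS //|tN] := boolP (t \in facets (f_free D)).
have [x [xt xtD]] := facet_extend tD tN.
have xF : x \in free_facet F.
  by apply: (subsetP (f_free_inr xtD _)); rewrite ?setU11 // setU1r.
apply: (@cone_acyclic _ _ x) => r /mem_linkP[tr trD].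
have := f_free_inr trD (subsetP (subsetUl t r) _ Ft).
rewrite subUset => /andP[tF rF]; apply/mem_linkP; split.
  by rewrite -setI_eq0 setIUr setU_eq0 !setI_eq0 tr andbT disjoint_sym disjoints1.
by apply/mem_f_free; exists F; rewrite !subUset tF rF sub1set xF.
Qed.

(** For a facet both sides fail. Otherwise the new vertices are dominated in the link, and deleting
    them leaves a copy of [link D s]. *)
Lemma link_f_free_inl s k : s \in faces D ->
  nonzero_homology K (link (f_free D) (inl_set s)) k.+1 <->
  nonzero_homology K (link D s) k.+1.
Proof.
move=> sD.
have inlI (t : {set V}) : (inl_set t \in faces (link (f_free D) (inl_set s))) =
    (t \in faces (link D s)).
  have st : [disjoint inl_set s & inl_set t] = [disjoint s & t].
    by apply: imset_disjoint; exact: inl_inj.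
  by apply/mem_linkP/mem_linkP; rewrite -inl_setU inl_set_f_free st.
have [sF|sN] := boolP (s \in facets D).
  split=> [|/facet_homologyS //]; pose S : {F | F \in facets D} := Sub s sF.
  case/(@cone_acyclic _ _ (inr S)) => r /mem_linkP[sr /mem_f_free[G]].
  rewrite subUset inl_set_subset => /andP[sG rG]; apply/mem_linkP.
  (* By maximality [s] lies in no facet but itself, so the new vertex [inr S] is a cone apex of the
     link. *)
  have GS : G = S.
    apply: val_inj; have := sF; rewrite inE => /maxsetP[_]; apply=> //.
    exact: facet_face.
  split; last first.
    apply/mem_f_free; exists S; rewrite !subUset inl_set_subset -GS rG GS.
    by rewrite subxx sub1set inr_free_facet eqxx.
  rewrite -setI_eq0 setIUr setU_eq0 !setI_eq0 sr andbT disjoint_sym disjoints1.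
  by apply/imsetP => -[].
(* [v0] only fills the default of [odflt]: a facet [F] containing the non-facet [s] has a vertex
   outside [s], so [pick] succeeds. That vertex dominates [inr F]. *)
have [v0 [v0s v0D]] := facet_extend sD sN.
pose v (x : free_vertex D) : free_vertex D :=
  if x is inr F then inl (odflt v0 [pick w in val F :\: s]) else x.
pose U : {set free_vertex D} := [set x | ~~ is_inl x].
have linkD t : t \in faces (link (f_free D) (inl_set s)) -> t \in faces (f_free D).
  by rewrite inE => /and3P[].
apply: iff_trans (iff_sym (@nonzero_homology_deletion _ _ _ U v _ _ _ _)) _.
- move=> t [x|F] [y|G] /linkD tD; rewrite !inE // => _ _ Ft Gt.
  by move: (subsetP (f_free_inr tD Gt) _ Ft); rewrite inr_free_facet => /eqP->.
- by case=> [x|F]; rewrite !inE.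
- move=> t [x|F] /mem_linkP[st stD] xU Ft; first by rewrite inE in xU.
  have := f_free_inr stD (subsetP (subsetUr _ t) _ Ft).
  rewrite subUset inl_set_subset => /andP[sF tF].
  rewrite /v; case: pickP => [w|none]; last first.
    case/negP: sN; suff <- : val F = s by exact: valP.
    apply/eqP; rewrite eqEsubset sF andbT; apply/subsetP => w wF.
    by have := none w; rewrite inE wF andbT => /negbFE.
  rewrite [odflt _ _]/= in_setD => /andP[ws wF]; apply/mem_linkP; split.
    rewrite -setI_eq0 setIUr setU_eq0 !setI_eq0 st andbT disjoint_sym disjoints1.
    by rewrite mem_imset //; exact: inl_inj.
  apply/mem_f_free; exists F.
  by rewrite !subUset inl_set_subset sF tF sub1set inl_free_facet wF.
(* The faces of the link without new vertices are the images under [inl] of the faces of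
   [link D s]. *)
apply: (@nonzero_homology_relabel _ _ _ inl).
  by move=> x y; rewrite !enum_rank_inl.
apply/setP => t; rewrite inE; apply/andP/imsetP => [[tL Ut]|[r rL ->]].
  have tE : t = inl_set [set w | inl w \in t].
    apply: inl_set_preim => F; apply/negP => Ft.
    by move/disjointFl: Ut => /(_ _ Ft); rewrite inE.
  by exists [set w | inl w \in t]; rewrite // -inlI -tE.
rewrite inlI; split=> //; rewrite -setI_eq0; apply/eqP/setP => x; rewrite !inE.
by apply/andP => -[+ /imsetP[w _ xw]]; rewrite xw.
Qed.

End FreeComplex.

Theorem corollary6p7 (K : fieldType) (V : finType) (D : simplicial_complex V)
  (d : seq int) (d1 : int)
  (hPR : PR K D) (hd : degree_type K D (rcons d d1)) :
  PR K (f_free D) /\ degree_type K (f_free D) (rcons d (d1 + 1)%R).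
Proof.
have H0 (t : {set free_vertex D}) : t \in faces (f_free D) ->
    nonzero_homology K (link (f_free D) t) 0 ->
  exists2 F, F \in facets D & #|t| = #|F|.+1.
  move=> tD /facet_homology-/(_ tD); rewrite facets_f_free => /imsetP[F _ ->].
  by exists (val F); rewrite ?card_free_facet // (valP F).
(* In nonnegative degrees a face with homology has no new vertex, so it comes from a face of [D] of
   the same size. *)
have HS (t : {set free_vertex D}) k : t \in faces (f_free D) ->
    nonzero_homology K (link (f_free D) t) k.+1 ->
  exists s, [/\ s \in faces D, nonzero_homology K (link D s) k.+1 & #|t| = #|s|].
  move=> tD tk; have tN F : inr F \notin t.
    by apply/negP => Ft; exact: (link_f_free_inr tD Ft tk).
  move: tD tk; rewrite (inl_set_preim tN) inl_set_f_free => sD.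
  move=> /(link_f_free_inl K k sD) sk.
  by eexists; split; eauto; rewrite card_imset //; exact: inl_inj.
have facetD F : F \in facets D -> F \in faces D by rewrite inE => /maxsetp.
split=> [[|k] s t sD tD|].
- move=> /(H0 _ sD)[F FD ->] /(H0 _ tD)[G GD ->]; congr _.+1.
  apply: (hPR 0 _ _ (facetD _ FD) (facetD _ GD));
    by apply/facet_homology; rewrite ?facetD.
- move=> /(HS _ _ sD)[s' [s'D s'k ->]] /(HS _ _ tD)[t' [t'D t'k ->]].
  exact: hPR s'D t'D s'k t'k.
case: hd => sz []; rewrite !size_rcons => top ex diff.
(* Only the size of the facets, which carry degree -1, grows. *)
exists (fun i => if i is 0 then (sz 0).+1 else sz i); rewrite size_rcons; split.
- move=> [//|k] t tD /(HS _ _ tD)[s [sD sk _]]; exact: top sk.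
- move=> [_|i id].
    have [s [sD /(facet_homology _ sD) sF <-]] := ex 0 isT.
    have FF : free_facet (Sub s sF) \in facets (f_free D).
      by rewrite facets_f_free imset_f.
    exists (free_facet (Sub s sF)).
    have FD : free_facet (Sub s sF) \in faces (f_free D).
      by move: FF; rewrite inE => /maxsetp.
    by split; [exact: FD | apply/facet_homology | rewrite card_free_facet].
  have [s [sD sk <-]] := ex i.+1 id; exists [set inl v | v in s].
  split; first by rewrite inl_set_f_free.
    exact/link_f_free_inl.
  by rewrite card_imset //; exact: inl_inj.
(* Index 1 reads the last entry, the only difference involving [sz 0]; larger indices read inside
   [d], where nothing changes. *)
move=> [//|[_|i /andP[_ id]]].
  have := diff 1 isT; rewrite !subn1 /= !nth_rcons ltnn eqxx => ->.
  by rewrite -addn1 PoszD addrAC.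
by rewrite -diff //= !nth_rcons subSS ltn_subrL (leq_ltn_trans (leq0n i) id).
Qed.
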